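(* Let $\mathbb{K}$ be a commutative semiring and $(\Sigma,M)$ an OP alphabet. Let $\mathcal{A}$ be a wOPA over $(\Sigma,M)$ and $\mathbb{K}$. Then there exists an rwOPA $\mathcal{B}$ over $(\Sigma,M)$ and $\mathbb{K}$ with $[\![\mathcal{A}]\!]=[\![\mathcal{B}]\!]$.
   Context: A semiring $\mathbb{K}=(K,+,\cdot,0,1)$ has $(K,+,0)$ a commutative monoid, $(K,\cdot,1)$ a monoid, both distributive laws, and $0\cdot x=x\cdot 0=0$; it is commutative if $(K,\cdot,1)$ is commutative. OP alphabets. An OP alphabet is a pair $(\Sigma,M)$ where $\Sigma$ is a finite alphabet, $\#\notin\Sigma$, and $M$ (the operator precedence matrix, OPM) assigns to each ordered pair of symbols of $\Sigma\cup\{\#\}$ at most one of the relations $\lessdot,\doteq,\gtrdot$ (an entry may be empty); we write $a\lessdot b$, $a\doteq b$, $a\gtrdot b$. Always $\#\lessdot a$ and $a\gtrdot\#$ for all $a\in\Sigma$. For $w=a_1\cdots a_n\in\Sigma^+$ put $a_0=a_{n+1}=\#$. The chain relation $\curvearrowright$ on $\{0,\dots,n+1\}$ is defined inductively: for $i<j$, $i\curvearrowright j$ if there are positions $i=k_1<\dots<k_m=j$ with $a_{k_1}\lessdot a_{k_2}\doteq\dots\doteq a_{k_{m-1}}\gtrdot a_{k_m}$ and, for each $s\in\{1,\dots,m-1\}$, either $k_s+1=k_{s+1}$ or $k_s\curvearrowright k_{s+1}$. The word $w$ is compatible with $M$ if $0\curvearrowright n+1$; $(\Sigma,M)^+$ is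 the set of all non-empty words over $\Sigma$ compatible with $M$. Automata. A (nondeterministic) OPA over $(\Sigma,M)$ is $(Q,I,F,\delta)$ with $Q$ a finite set of states, $I,F\subseteq Q$ (initial, final), and $\delta=(\delta_{\mathrm{shift}},\delta_{\mathrm{push}},\delta_{\mathrm{pop}})$, $\delta_{\mathrm{shift}},\delta_{\mathrm{push}}\subseteq Q\times\Sigma\times Q$, $\delta_{\mathrm{pop}}\subseteq Q\times Q\times Q$. A weighted OPA (wOPA) over $(\Sigma,M)$ and $\mathbb{K}$ is $\mathcal{A}=(Q,I,F,\delta,\mathrm{wt})$ with $(Q,I,F,\delta)$ an OPA and $\mathrm{wt}=(\mathrm{wt}_{\mathrm{shift}},\mathrm{wt}_{\mathrm{push}},\mathrm{wt}_{\mathrm{pop}})$, $\mathrm{wt}_{op}:\delta_{op}\to K$. It is restricted (an rwOPA) if $\mathrm{wt}_{\mathrm{pop}}\equiv 1$. A configuration is $\langle\Pi,q,u\#,k\rangle$ with stack $\Pi\in\bot(\Sigma\times Q)^*$, state $q$, remaining input $u\#$, and $k\in K$. With $a$ the topmost alphabet symbol of the stack ($a=\#$ if the stack is $\bot$) and $b$ the next input symbol, moves are: push: $\langle\Pi,q,bx,k\rangle\vdash\langle\Pi[b,q],r,x,k\cdot\mathrm{wt}_{\mathrm{push}}(q,b,r)\rangle$ if $a\lessdot b$, $(q,b,r)\in\delta_{\mathrm{push}}$; shift: $\langle\Pi[a,p],q,bx,k\rangle\vdash\langle\Pi[b,p],r,x,k\cdot\mathrm{wt}_{\mathrm{shift}}(q,b,r)\rangle$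 if $a\doteq b$, $(q,b,r)\in\delta_{\mathrm{shift}}$; pop: $\langle\Pi[a,p],q,bx,k\rangle\vdash\langle\Pi,r,bx,k\cdot\mathrm{wt}_{\mathrm{pop}}(q,p,r)\rangle$ if $a\gtrdot b$, $(q,p,r)\in\delta_{\mathrm{pop}}$. An accepting run on $w$ is a finite sequence of moves from $\langle\bot,q_I,w\#,1\rangle$ to $\langle\bot,q_F,\#,k\rangle$ with $q_I\in I$, $q_F\in F$; its weight is $\mathrm{wt}(\rho)=k$. The behavior is $[\![\mathcal{A}]\!]:(\Sigma,M)^+\to K$, $[\![\mathcal{A}]\!](w)=\sum_{\rho}\mathrm{wt}(\rho)$, summed over all accepting runs $\rho$ of $\mathcal{A}$ on $w$. *)

(* Defs.v *)
From HB Require Import structures.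
From mathcomp Require Import all_boot all_order all_algebra.
From mathcomp Require Import boolp classical_sets functions cardinality fsbigop.

Set Implicit Arguments.
Unset Strict Implicit.
Unset Printing Implicit Defensive.

Import GRing.Theory.
Local Open Scope ring_scope.
Local Open Scope classical_set_scope.

(* Yields is the relation ⋖, Equals is ≐, Takes is ⋗. *)
Variant prec := Yields | Equals | Takes.

(* The symbols of Σ ∪ {#} are the elements of [option Sigma], # being [None];
   an empty matrix entry is the value [None]. *)
Record opm (Sigma : finType) := Opm {
  opm_entry :> option Sigma -> option Sigma -> option prec;
  opm_first : forall a : Sigma, opm_entry None (Some a) = Some Yields;
  opm_last : forall a : Sigma, opm_entry (Some a) None = Some Takes
}.

(* a_i for a word w = a_1 ... a_n, with a_0 = a_{n+1} = #. *)
Definition letter (Sigma : finType) (w : seq Sigma) (i : nat) : option Sigma :=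
  if i is i'.+1 then onth w i' else None.

(* The positions are k 1 < ... < k m.  The pattern
   a_{k_1} ⋖ a_{k_2} ≐ ... ≐ a_{k_{m-1}} ⋗ a_{k_m} requires m >= 3: for m = 2
   the same matrix entry would have to be both ⋖ and ⋗. *)
Inductive chain (Sigma : finType) (M : opm Sigma) (w : seq Sigma) :
    nat -> nat -> Prop :=
| Chain (m : nat) (k : nat -> nat) of
    (3 <= m)%N &
    (forall s, (1 <= s < m)%N -> (k s < k s.+1)%N) &
    (k m <= (size w).+1)%N &
    M (letter w (k 1%N)) (letter w (k 2%N)) = Some Yields &
    (forall s, (2 <= s < m.-1)%N ->
       M (letter w (k s)) (letter w (k s.+1)) = Some Equals) &
    M (letter w (k m.-1)) (letter w (k m)) = Some Takes &
    (forall s, (1 <= s < m)%N ->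
       (k s).+1 = k s.+1 \/ chain M w (k s) (k s.+1)) :
    chain M w (k 1%N) (k m).

Definition compatible (Sigma : finType) (M : opm Sigma) (w : seq Sigma) : Prop :=
  chain M w 0 (size w).+1.

(* (Σ,M)^+ *)
Definition opword (Sigma : finType) (M : opm Sigma) : Type :=
  {w : seq Sigma | w <> [::] /\ compatible M w}.

Record opa (Sigma : finType) (M : opm Sigma) := Opa {
  state : finType;
  initial : {set state};
  final : {set state};
  delta_shift : {set state * Sigma * state};
  delta_push : {set state * Sigma * state};
  delta_pop : {set state * state * state}
}.

(* The weights of triples outside the corresponding transition relation are
   never used. *)
Record wopa (Sigma : finType) (M : opm Sigma) (K : pzSemiRingType) := Wopa {
  wopa_opa :> opa M;
  wt_shift : state wopa_opa * Sigma * state wopa_opa -> K;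
  wt_push : state wopa_opa * Sigma * state wopa_opa -> K;
  wt_pop : state wopa_opa * state wopa_opa * state wopa_opa -> K
}.
Arguments wt_shift {Sigma M K} A t : rename.
Arguments wt_push {Sigma M K} A t : rename.
Arguments wt_pop {Sigma M K} A t : rename.

Definition restricted (Sigma : finType) (M : opm Sigma) (K : pzSemiRingType)
    (A : wopa M K) : Prop :=
  forall t, t \in delta_pop A -> wt_pop A t = 1.

(* [(st, q, u, k)] is the configuration <Π, q, u#, k>; the top of the stack Π
   is the head of the list [st], and ⊥ is the empty list. *)
Definition config (Sigma : finType) (M : opm Sigma) (K : pzSemiRingType)
    (A : wopa M K) : choiceType :=
  (seq (Sigma * state A) * state A * seq Sigma * K)%type.

Definition top_symbol (Sigma : finType) (Q : Type) (st : seq (Sigma * Q)) :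
    option Sigma :=
  omap fst (ohead st).

(* The next input symbol of the remaining input u# is [ohead u]. *)
Inductive move (Sigma : finType) (M : opm Sigma) (K : pzSemiRingType)
    (A : wopa M K) : config A -> config A -> Prop :=
| Push st q b x r k of
    M (top_symbol st) (Some b) = Some Yields & (q, b, r) \in delta_push A :
    move (st, q, b :: x, k) ((b, q) :: st, r, x, k * wt_push A (q, b, r))
| Shift st a p q b x r k of
    M (Some a) (Some b) = Some Equals & (q, b, r) \in delta_shift A :
    move ((a, p) :: st, q, b :: x, k)
         ((b, p) :: st, r, x, k * wt_shift A (q, b, r))
| Pop st a p q x r k of
    M (Some a) (ohead x) = Some Takes & (q, p, r) \in delta_pop A :
    move ((a, p) :: st, q, x, k) (st, r, x, k * wt_pop A (q, p, r)).

Fixpoint moves (Sigma : finType) (M : opm Sigma) (K : pzSemiRingType)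
    (A : wopa M K) (c : config A) (cs : seq (config A)) : Prop :=
  if cs is c' :: cs' then move c c' /\ moves c' cs' else True.

(* A run, as the sequence of the configurations it visits: the first one
   together with the following ones.  Two consecutive configurations determine
   the move between them. *)
Definition run (Sigma : finType) (M : opm Sigma) (K : pzSemiRingType)
    (A : wopa M K) : choiceType :=
  (config A * seq (config A))%type.

Definition accepting_runs (Sigma : finType) (M : opm Sigma)
    (K : pzSemiRingType) (A : wopa M K) (w : seq Sigma) : set (run A) :=
  [set rho | moves rho.1 rho.2 /\
     exists qI qF k, [/\ qI \in initial A, qF \in final A,
       rho.1 = ([::], qI, w, 1) & last rho.1 rho.2 = ([::], qF, [::], k)]].
Arguments accepting_runs {Sigma M K} A w.

Definition run_weight (Sigma : finType) (M : opm Sigma) (K : pzSemiRingType)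
    (A : wopa M K) (rho : run A) : K :=
  (last rho.1 rho.2).2.

(* By [finite_accepting_runs] below the sum is over a finite set, so that the
   default value of [\sum_(_ \in _) _] for infinite supports never occurs. *)
Definition behavior (Sigma : finType) (M : opm Sigma) (K : pzSemiRingType)
    (A : wopa M K) (w : opword M) : K :=
  \sum_(rho \in accepting_runs A (sval w)) run_weight rho.

Section Finiteness.
Variables (Sigma : finType) (M : opm Sigma) (K : pzSemiRingType).
Variable A : wopa M K.

Definition potential (c : config A) : nat :=
  ((size c.1.2).*2 + size c.1.1.1)%N.

Lemma move_potential (c c' : config A) :
  move c c' -> (potential c' < potential c)%N.
Proof.
by case=> *; rewrite /potential /= ?doubleS ?addSn ?addnS ?ltnS ?leqnSn.
Qed.

Lemma finite_move (c : config A) : finite_set [set c' | move c c'].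
Proof.
case: c => [[[st q] u] k].
pose succ (t : 'I_3 * state A) : config A :=
  let: (i, r) := t in
  match st, u with
  | (a, p) :: st', b :: x =>
      if i == 0 :> nat then ((b, q) :: st, r, x, k * wt_push A (q, b, r))
      else if i == 1%N :> nat
      then ((b, p) :: st', r, x, k * wt_shift A (q, b, r))
      else (st', r, u, k * wt_pop A (q, p, r))
  | (a, p) :: st', [::] => (st', r, u, k * wt_pop A (q, p, r))
  | [::], b :: x => ((b, q) :: st, r, x, k * wt_push A (q, b, r))
  | [::], [::] => (st, q, u, k)
  end.
apply: (@sub_finite_set _ _ (succ @` setT)); last exact: finite_image.
move=> c' /= mv; inversion mv; subst.
- exists (inord 0, r) => //; rewrite /succ inordK //=.
  by case: (st) => [|[a p] st'].
- by exists (inord 1, r) => //; rewrite /succ inordK.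
- exists (inord 2, r) => //; rewrite /succ inordK //.
  by case: (u).
Qed.

Lemma finite_moves (c : config A) : finite_set [set cs | moves c cs].
Proof.
have [n] := ubnP (potential c); elim: n c => // n IHn c; rewrite ltnS => le_c.
apply: (@sub_finite_set _ _ ([set [::]] `|`
  \bigcup_(c' in [set c' | move c c']) (cons c' @` [set cs | moves c' cs]))).
  move=> [|c' cs] /=; first by left.
  by move=> [mv mvs]; right; exists c' => //; exists cs.
rewrite finite_setU; split; first exact: finite_set1.
apply: bigcup_finite; first exact: finite_move.
move=> c' /= mv; apply: finite_image; apply: IHn.
exact: leq_trans (move_potential mv) le_c.
Qed.

Lemma finite_accepting_runs (w : seq Sigma) :
  finite_set (accepting_runs A w).
Proof.
apply: (@sub_finite_set _ _ (\bigcup_(qI in [set: state A])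
  (pair ([::], qI, w, 1) @` [set cs | moves ([::], qI, w, 1) cs]))).
  move=> [c cs] /= [mv [qI [qF [k [_ _ /= cE _]]]]].
  by rewrite cE in mv *; exists qI => //; exists cs.
apply: bigcup_finite => [//|qI _]; apply: finite_image.
exact: finite_moves.
Qed.

End Finiteness.

(* Main.v *)
Require Import Defs.
From mathcomp Require Import all_boot all_order all_algebra.
From mathcomp Require Import boolp classical_sets functions cardinality fsbigop.

(* When pushing, the restricted automaton guesses the states of A just before
   and just after the pop that will remove the new stack frame, and multiplies
   the weight of the push by the weight of that pop; the pop itself then has
   weight 1 and only checks the guess.  Each accepting run of A extends to
   exactly one accepting run with guesses, of the same weight up to
   commutativity.  Instead of exhibiting this bijection, both behaviors are
   unfolded move by move, and a sum over guesses for all frames of the current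
   stack is carried along. *)

Set Implicit Arguments.
Unset Strict Implicit.
Unset Printing Implicit Defensive.

Import GRing.Theory.
Local Open Scope ring_scope.
Local Open Scope classical_set_scope.

(** * Finite sums over disjoint unions *)

Section FsbigBigcup.
Variables (R : Type) (idx : R) (op : Monoid.com_law idx).

Lemma fsbig_bigcup_seq (I T : choiceType) (r : seq I) (D : I -> set T)
    (F : T -> R) :
    uniq r -> (forall i, finite_set (D i)) -> trivIset setT D ->
  \big[op/idx]_(x \in \bigcup_(i in [set` r]) D i) F x =
  \big[op/idx]_(i <- r) \big[op/idx]_(x \in D i) F x.
Proof.
move=> + finD trivD; elim: r => [_|i r IHr /= /andP[ir ur]].
  by rewrite set_nil bigcup_set0 fsbig_set0 big_nil.
have -> : [set` i :: r] = i |` [set` r].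
  by apply/seteqP; split=> j /=; rewrite inE;
    [case/predU1P|case=> [->|->]]; rewrite ?eqxx ?orbT //; [left|right].
rewrite bigcup_setU1 fsbigU0 ?big_cons ?IHr //.
  exact: bigcup_finite.
move=> x [Dix [j /= jr Djx]]; move: ir.
by rewrite (trivD i j) ?jr //; exists x.
Qed.

(** Serves to split a sum over runs by the initial state or by the target of the first move. Joint
    injectivity of [f] makes the images disjoint and lets each be reindexed by its [D i]. *)
Lemma fsbig_bigcup_image (I : finType) (T U : choiceType) (P : pred I)
    (f : I -> T -> U) (D : I -> set T) (F : U -> R) :
    (forall i, finite_set (D i)) ->
    (forall i j x y, f i x = f j y -> i = j /\ x = y) ->
  \big[op/idx]_(u \in \bigcup_(i in [set i | P i]) (f i @` D i)) F u =
  \big[op/idx]_(i | P i) \big[op/idx]_(x \in D i) F (f i x).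
Proof.
move=> finD injf.
have -> : [set i | P i] = [set` [seq i <- index_enum I | P i]].
  by apply/seteqP; split=> i /=; rewrite mem_filter mem_index_enum andbT.
rewrite fsbig_bigcup_seq ?filter_uniq ?index_enum_uniq //; first last.
- by move=> i j _ _ [u [[x _ <-] [y _ /injf[-> _]]]].
- by move=> i; exact: finite_image.
rewrite big_filter; apply: eq_bigr => i _; rewrite fsbig_image //.
by move=> x y _ _ /injf[].
Qed.

End FsbigBigcup.

(** * Unfolding the behavior move by move *)

Section Total.
Variables (Sigma : finType) (M : opm Sigma) (K : pzSemiRingType).
Variable A : wopa M K.

Definition accepting (c : config A) : Prop :=
  exists qF k, qF \in final A /\ c = ([::], qF, [::], k).

Definition tails (c : config A) : set (seq (config A)) :=
  [set cs | moves c cs /\ accepting (last c cs)].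

Lemma finite_tails (c : config A) : finite_set (tails c).
Proof. by apply: sub_finite_set (finite_moves c) => cs []. Qed.

(** A configuration that is not accepting has no empty tail, so every tail starts with a move. A
    state alone can index the successors because a matrix entry allows only one kind of move. *)
Lemma tails_step (c : config A) (P : pred (state A))
    (succ : state A -> config A) :
    injective succ ->
    (forall c', move c c' <-> exists2 r, P r & c' = succ r) ->
    ~ accepting c ->
  \sum_(cs \in tails c) (last c cs).2 =
  \sum_(r | P r) \sum_(cs \in tails (succ r)) (last (succ r) cs).2.
Proof.
move=> inj_succ moveP Nacc.
have -> : tails c =
    \bigcup_(r in [set r | P r]) (cons (succ r) @` tails (succ r)).
  apply/seteqP; split=> [[|c' cs] /= []|_ [r /= Pr [cs [mv acc] <-]]].
  - by move=> _ /Nacc.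
  - move=> [/moveP[r Pr ->] mvs] acc.
    by exists r => //; exists cs.
  - by split=> //; split=> //; apply/moveP; exists r.
rewrite fsbig_bigcup_image // => [r|r r' cs cs' [/inj_succ-> ->] //].
exact: finite_tails.
Qed.

(* The sum of the weights of the ways to complete a run from the
   configuration (st, q, u, 1) in fewer than n moves. *)
Fixpoint total (n : nat) (st : seq (Sigma * state A)) (q : state A)
    (u : seq Sigma) : K :=
  if n isn't n'.+1 then 0 else
  match M (top_symbol st) (ohead u), st, u with
  | _, [::], [::] => (q \in final A)%:R
  | Some Yields, _, b :: x =>
      \sum_(r | (q, b, r) \in delta_push A)
        wt_push A (q, b, r) * total n' ((b, q) :: st) r x
  | Some Equals, (a, p) :: st', b :: x =>
      \sum_(r | (q, b, r) \in delta_shift A)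
        wt_shift A (q, b, r) * total n' ((b, p) :: st') r x
  | Some Takes, (a, p) :: st', _ =>
      \sum_(r | (q, p, r) \in delta_pop A)
        wt_pop A (q, p, r) * total n' st' r u
  | _, _, _ => 0
  end.

(** Every move lowers [potential], so a bound [n] above it cuts no run short. *)
Lemma sum_tails (n : nat) st (q : state A) u k :
    (potential ((st, q, u, k) : config A) < n)%N ->
  \sum_(cs \in tails (st, q, u, k)) (last (st, q, u, k) cs).2 =
  k * total n st q u.
Proof.
elim: n st q u k => // n IHn st q u k; rewrite ltnS => lt_n.
have step (P : pred (state A)) st' u' (wt : state A -> K) :
    (forall c', move ((st, q, u, k) : config A) c' <->
       exists2 r, P r & c' = (st', r, u', k * wt r)) ->
    ~ accepting (st, q, u, k) ->
    \sum_(cs \in tails (st, q, u, k)) (last (st, q, u, k) cs).2 =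
    k * \sum_(r | P r) wt r * total n st' r u'.
  move=> moveP Nacc.
  rewrite (tails_step (succ := fun r => (st', r, u', k * wt r)) _ moveP) //.
    rewrite mulr_sumr; apply: eq_bigr => r Pr; rewrite mulrA IHn //.
    apply: leq_trans lt_n; apply: move_potential; apply/moveP.
    by exists r.
  by move=> r r' [].
have stuck : (forall c', ~ move ((st, q, u, k) : config A) c') ->
    ~ accepting (st, q, u, k) ->
    \sum_(cs \in tails (st, q, u, k)) (last (st, q, u, k) cs).2 = k * 0.
  move=> Nmove Nacc.
  (* A dead end is a step with an empty set of targets. *)
  rewrite (step pred0 st u (fun=> 0)) ?big_pred0 // => c'.
  by split=> [/Nmove|[]].
case: st u lt_n step stuck => [|[a p] st] [|b x] lt_n step stuck /=.
(* With empty stack and empty input no move exists, so only the empty tail can occur. The entry of #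
   against # is arbitrary, hence the case analyses on [M _ _]. *)
- have -> : tails ([::], q, [::], k) =
      if q \in final A then [set [::]] else set0.
    apply/seteqP; split=> [[|c cs]|cs].
    + by move=> [_ [qF [k' [qFF [-> _]]]]]; rewrite qFF.
    + by move=> [[mv _] _]; inversion mv.
    + case: ifP => // qF -> /=.
      by split=> //; exists q, k.
  case: ifP => qF; last by rewrite fsbig_set0; case: (M _ _) => [[]|];
    rewrite mulr0.
  by rewrite fsbig_set1 /=; case: (M _ _) => [[]|]; rewrite mulr1.
- rewrite opm_first; apply: step; last by case=> ? [? []].
  move=> c'; split=> [mv|[r ? ->]]; last by apply: Push => //; exact: opm_first.
  by inversion mv; subst; exists r.
- rewrite opm_last; apply: step; last by case=> ? [? []].
  move=> c'; split=> [mv|[r ? ->]]; last by apply: Pop => //; exact: opm_last.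
  by inversion mv; subst; exists r.
- case Mab: (M _ _) => [[]|].
  + apply: step; last by case=> ? [? []].
    move=> c'; split=> [mv|[r ? ->]]; last exact: Push.
    by inversion mv; subst; unfold top_symbol in *; simpl in *; try congruence; exists r.
  + apply: step; last by case=> ? [? []].
    move=> c'; split=> [mv|[r ? ->]]; last exact: Shift.
    by inversion mv; subst; unfold top_symbol in *; simpl in *; try congruence; exists r.
  + apply: step; last by case=> ? [? []].
    move=> c'; split=> [mv|[r ? ->]]; last exact: Pop.
    by inversion mv; subst; unfold top_symbol in *; simpl in *; try congruence; exists r.
  + apply: stuck; last by case=> ? [? []].
    by move=> c' mv; inversion mv; subst; unfold top_symbol in *; simpl in *; congruence.
Qed.

(** The stack is empty at the start, so the initial [potential] is twice the length of the word. *)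
Lemma behavior_total (w : opword M) (n : nat) :
    ((size (sval w)).*2 < n)%N ->
  behavior A w = \sum_(q in initial A) total n [::] q (sval w).
Proof.
move=> lt_n; rewrite /behavior.
pose c0 q : config A := ([::], q, sval w, 1).
have -> : accepting_runs A (sval w) =
    \bigcup_(q in [set q | q \in initial A]) (pair (c0 q) @` tails (c0 q)).
  apply/seteqP; split=> [[c cs] /= [mv [qI [qF [k [qII qFF cE lastE]]]]]|].
    rewrite /= in cE lastE; rewrite cE in mv lastE *.
    by exists qI => //; exists cs => //; split=> //; exists qF, k.
  move=> _ [q /= qI [cs [mv [qF [k [qFF lastE]]]] <-]]; split=> //.
  by exists q, qF, k.
rewrite fsbig_bigcup_image.
- apply: eq_bigr => q qI; rewrite -[RHS]mul1r -(@sum_tails n) //.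
  by rewrite /potential /= addn0.
- by move=> q; exact: finite_tails.
- by move=> q q' cs cs' [-> ->].
Qed.

End Total.
Arguments total {Sigma M K} A n st q u : rename.

(** * The restricted automaton and sums over guesses *)

Section Restriction.
Variables (Sigma : finType) (M : opm Sigma) (K : comPzSemiRingType).
Variable A : wopa M K.

Let Q : finType := state A.
Let guess : finType := (Q * Q)%type.

(* The guess Some (q', r) of a state announces that the topmost stack frame
   will be popped in state q' of A, leading to state r; the guess is None
   exactly when the stack is empty.  The frame stores the guess in force
   before the push, which the pop restores. *)
Definition rstate : finType := (Q * option guess)%type.

Definition rpush : {set rstate * Sigma * rstate} :=
  [set t | let: ((q, g), b, (r, g')) := t in
     if g' is Some (q', r') then
       ((q, b, r) \in delta_push A) && ((q', q, r') \in delta_pop A)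
     else false].

Definition rshift : {set rstate * Sigma * rstate} :=
  [set t | let: ((q, g), b, (r, g')) := t in
     ((q, b, r) \in delta_shift A) && (g' == g)].

Definition rpop : {set rstate * rstate * rstate} :=
  [set t | let: ((q, g), (p, g0), (r, g')) := t in
     [&& g == Some (q, r), g' == g0 & (q, p, r) \in delta_pop A]].

Definition ropa : opa M :=
  @Opa Sigma M rstate [set (q, None) | q in initial A]
    [set (q, None) | q in final A] rshift rpush rpop.

Definition rwopa : wopa M K :=
  @Wopa Sigma M K ropa
    (fun t : rstate * Sigma * rstate =>
       wt_shift A (t.1.1.1, t.1.2, t.2.1))
    (fun t : rstate * Sigma * rstate =>
       if t.2.2 is Some (q', r') then
         wt_push A (t.1.1.1, t.1.2, t.2.1) * wt_pop A (q', t.1.1.1, r')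
       else 0)
    (fun=> 1).

(* The sum of f over the ways to annotate the stack st with guesses, each
   weighted by the product of the weights of the announced pops. *)
Fixpoint guess_sum (st : seq (Sigma * Q))
    (f : seq (Sigma * rstate) -> option guess -> K) : K :=
  if st is (a, p) :: st' then
    guess_sum st' (fun stB g =>
      \sum_(G : guess | (G.1, p, G.2) \in delta_pop A)
        wt_pop A (G.1, p, G.2) * f ((a, (p, g)) :: stB) (Some G))
  else f [::] None.

(** Annotating keeps the letters of the stack; hence the matrix entry that selects the move of [A]
    also selects the move of [rwopa]. *)
Lemma eq_guess_sum st f1 f2 :
  (forall stB g, top_symbol stB = top_symbol st -> f1 stB g = f2 stB g) ->
  guess_sum st f1 = guess_sum st f2.
Proof.
elim: st f1 f2 => [|[a p] st IHst] f1 f2 eqf /=; first exact: eqf.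
by apply: IHst => stB g _; apply: eq_bigr => G _; rewrite eqf.
Qed.

Lemma guess_sum0 st : guess_sum st (fun _ _ => 0) = 0.
Proof.
elim: st => [|[a p] st IHst] //=; rewrite -[RHS]IHst.
by apply: eq_guess_sum => stB g _; apply: big1 => G _; rewrite mulr0.
Qed.

Lemma guess_sumD st f1 f2 :
  guess_sum st (fun stB g => f1 stB g + f2 stB g) =
  guess_sum st f1 + guess_sum st f2.
Proof.
elim: st f1 f2 => [|[a p] st IHst] //= f1 f2; rewrite -IHst.
apply: eq_guess_sum => stB g _; rewrite -big_split /=.
by apply: eq_bigr => G _; rewrite mulrDr.
Qed.

(** Commutativity of [K] carries [k] past the weights of the announced pops. *)
Lemma guess_sumM st k f :
  guess_sum st (fun stB g => k * f stB g) = k * guess_sum st f.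
Proof.
elim: st f => [|[a p] st IHst] //= f; rewrite -IHst.
apply: eq_guess_sum => stB g _; rewrite mulr_sumr.
by apply: eq_bigr => G _; rewrite mulrCA.
Qed.

Lemma guess_sum_sum st (I : Type) (s : seq I) (P : pred I) (k : I -> K)
    (f : I -> seq (Sigma * rstate) -> option guess -> K) :
  guess_sum st (fun stB g => \sum_(i <- s | P i) k i * f i stB g) =
  \sum_(i <- s | P i) k i * guess_sum st (f i).
Proof.
elim: s => [|i s IHs].
  rewrite big_nil -[RHS](guess_sum0 st).
  by apply: eq_guess_sum => stB g _; rewrite big_nil.
rewrite big_cons -IHs; case Pi: (P i).
  rewrite -guess_sumM -guess_sumD.
  by apply: eq_guess_sum => stB g _; rewrite big_cons Pi.
by apply: eq_guess_sum => stB g _; rewrite big_cons Pi.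
Qed.

(** * Single moves of the restricted automaton, and the comparison of totals *)

Lemma sum_rpush (q : Q) (g : option guess) (b : Sigma) (F : rstate -> K) :
  \sum_(t | ((q, g), b, t) \in rpush) wt_push rwopa ((q, g), b, t) * F t =
  \sum_(r | (q, b, r) \in delta_push A) wt_push A (q, b, r) *
    \sum_(G : guess | (G.1, q, G.2) \in delta_pop A)
      wt_pop A (G.1, q, G.2) * F (r, Some G).
Proof.
under [RHS]eq_bigr do rewrite mulr_sumr.
rewrite pair_big_dep /=.
(* Targets in [rpush] always carry a guess, so any default value will do in [odflt]. *)
rewrite (reindex_onto (fun s : Q * guess => (s.1, Some s.2))
  (fun t : rstate => (t.1, odflt (t.1, t.1) t.2))) /=.
  apply: eq_big => [[r [q' r']]|[r [q' r']] _] /=; last by rewrite mulrA.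
  by rewrite !inE eqxx andbT.
by move=> [r [[q' r']|]]; rewrite inE.
Qed.

Lemma sum_rshift (q : Q) (g : option guess) (b : Sigma) (F : rstate -> K) :
  \sum_(t | ((q, g), b, t) \in rshift) wt_shift rwopa ((q, g), b, t) * F t =
  \sum_(r | (q, b, r) \in delta_shift A) wt_shift A (q, b, r) * F (r, g).
Proof.
rewrite (reindex_onto (fun r : Q => (r, g)) fst) /=.
  by apply: eq_bigl => r; rewrite !inE !eqxx !andbT.
by move=> [r g']; rewrite inE => /andP[_ /eqP->].
Qed.

(** [rpop] forces [G = (q, r)], so the sum over guesses collapses to the pops possible now, and the
    weight paid for the guess becomes that of the pop. *)
Lemma sum_rpop (q p : Q) (g0 : option guess) (F : rstate -> K) :
  \sum_(G : guess | (G.1, p, G.2) \in delta_pop A) wt_pop A (G.1, p, G.2) *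
    \sum_(t | ((q, Some G), (p, g0), t) \in rpop)
      wt_pop rwopa ((q, Some G), (p, g0), t) * F t =
  \sum_(r | (q, p, r) \in delta_pop A) wt_pop A (q, p, r) * F (r, g0).
Proof.
under eq_bigr do rewrite mulr_sumr.
rewrite pair_big_dep /=.
rewrite (reindex_onto (fun r : Q => ((q, r), (r, g0)))
  (fun s : guess * rstate => s.2.1)) /=.
  apply: eq_big => [r|r _]; last by rewrite mul1r.
  by rewrite !inE !eqxx !andbT andbb.
move=> [[q' r'] [r g']] /=; rewrite inE => /andP[_ /and3P[]].
by move=> /eqP[-> ->] /eqP->.
Qed.

(** Moves of both automata correspond one to one in kind, so the same [n] serves both. A push opens
    a sum over the guess of the new frame, a shift preserves it, and a pop collapses it. *)
Lemma total_rwopa (n : nat) st (q : Q) (u : seq Sigma) :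
  total A n st q u =
  guess_sum st (fun stB g => total rwopa n stB (q, g) u).
Proof.
elim: n st q u => [|n IHn] st q u /=; first by rewrite guess_sum0.
have mem_final (g : option guess) :
    ((q, g) \in final rwopa) = (g == None) && (q \in final A).
  apply/imsetP/andP=> [[q' q'F [-> ->]]|[/eqP-> qF]] //.
  by exists q.
case Mtop: (M (top_symbol st) (ohead u)) => [[]|].
- case: u Mtop => [|b x] Mtop.
    case: st Mtop => [|[a p] st] Mtop /=; first by rewrite Mtop mem_final.
    by rewrite /top_symbol /= opm_last in Mtop.
  (* The middle term is [guess_sum] on the pushed stack, with its top layer unfolded and the sum
     over targets moved inside. *)
  transitivity (guess_sum st (fun stB g =>
      \sum_(r | (q, b, r) \in delta_push A) wt_push A (q, b, r) *
      \sum_(G : guess | (G.1, q, G.2) \in delta_pop A)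
         wt_pop A (G.1, q, G.2) *
           total rwopa n ((b, (q, g)) :: stB) (r, Some G) x)).
    rewrite guess_sum_sum; case: (st) => [|[a p] st'] //=;
    by apply: eq_bigr => r _; rewrite IHn.
  apply: eq_guess_sum => stB g top_stB; rewrite top_stB Mtop.
  rewrite -(sum_rpush q g b
    (fun t => total rwopa n ((b, (q, g)) :: stB) t x)).
  by case: stB top_stB.
- case: st Mtop => [|[a p] st]; case: u => [|b x] Mtop /=.
  + by rewrite Mtop mem_final.
  + by rewrite Mtop.
  + by rewrite /top_symbol /= opm_last in Mtop.
  rewrite /= in Mtop.
  under eq_bigr do rewrite IHn /=.
  rewrite -guess_sum_sum; apply: eq_guess_sum => stB g _ /=.
  (* A shift keeps the guess of the top frame, so the sums over guesses and targets are exchanged;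
     commutativity then brings the pop weight to the front. *)
  under eq_bigr do rewrite mulr_sumr.
  rewrite exchange_big; apply: eq_bigr => G _ /=; rewrite Mtop.
  under eq_bigr do rewrite mulrCA.
  rewrite -mulr_sumr; congr (_ * _); symmetry.
  exact: sum_rshift (fun t => total rwopa n ((b, (p, g)) :: stB) t x).
- case: st Mtop => [|[a p] st] Mtop /=.
    case: u Mtop => [|b x] Mtop /=; last by rewrite Mtop.
    by rewrite Mtop mem_final.
  rewrite /= in Mtop.
  under eq_bigr do rewrite IHn.
  rewrite -guess_sum_sum; apply: eq_guess_sum => stB g _ /=.
  rewrite -(sum_rpop q p g (fun t => total rwopa n stB t u)).
  by apply: eq_bigr => G _; rewrite Mtop.
- case: st Mtop => [|[a p] st]; case: u => [|b x] Mtop /=.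
  + by rewrite Mtop mem_final.
  + by rewrite Mtop.
  + by rewrite /top_symbol /= opm_last in Mtop.
  rewrite -[LHS](guess_sum0 st); apply: eq_guess_sum => stB g _.
  by rewrite big1 // => G _; rewrite Mtop mulr0.
Qed.

Lemma restricted_rwopa : restricted rwopa.
Proof. by []. Qed.

Lemma behavior_rwopa : behavior A =1 behavior rwopa.
Proof.
move=> w; have [n lt_n] := ubnP (size (sval w)).*2.
rewrite !(behavior_total _ lt_n).
rewrite [RHS]big_imset /=; last by move=> q q' _ _ [].
by apply: eq_bigr => q _; rewrite total_rwopa.
Qed.

End Restriction.

Theorem theorem10 (K : comPzSemiRingType) (Sigma : finType) (M : opm Sigma)
    (A : wopa M K) :
  exists B : wopa M K, restricted B /\ behavior A =1 behavior B.
Proof.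
by exists (rwopa A); split; [exact: restricted_rwopa | exact: behavior_rwopa].
Qed.
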